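(* Let $\Bbbk=\overline{\mathbb{F}}_p$ and let $\mathfrak{a}=\langle g_1,\ldots,g_m\rangle$ be a nonzero ideal of a polynomial ring $\Bbbk[x_1,\ldots,x_n]$ vanishing at a point $P\in\Bbbk^n$ (i.e. every element of $\mathfrak{a}$ vanishes at $P$). Identify a $\Bbbk$-linear combination $\gamma_1g_1+\cdots+\gamma_mg_m$ with the point $(\gamma_1,\ldots,\gamma_m)\in\Bbbk^m$. Then the set of all $(\gamma_1,\ldots,\gamma_m)\in\Bbbk^m$ for which $g=\gamma_1g_1+\cdots+\gamma_mg_m$ is nonzero and the $F$-pure threshold of $g$ at $P$ equals the least critical exponent of $\mathfrak{a}$ at $P$ is a nonempty (Zariski) open subset of $\Bbbk^m$.
   Context: The following definitions apply to any $F$-finite regular domain $S$ of characteristic $p>0$ ($F$-finite: $S$ is a finitely generated module over $S^p$). Frobenius powers: let $q$ denote a power $p^e$, $e\ge 0$. For an ideal $\mathfrak{a}$ of $S$, $\mathfrak{a}^{[q]}=\langle f^q: f\in\mathfrak{a}\rangle$. For $k\in\mathbb{N}$ with base $p$ expansion $k=k_0+k_1p+\cdots+k_rp^r$, $\mathfrak{a}^{[k]}=\mathfrak{a}^{k_0}(\mathfrak{a}^{k_1})^{[p]}\cdots(\mathfrak{a}^{k_r})^{[p^r]}$ (with $\mathfrak{a}^0=S$). $\mathfrak{a}^{[1/q]}$ is the smallest ideal $\mathfrak{c}$ of $S$ with $\mathfrak{a}\subseteq\mathfrak{c}^{[q]}$, and $\mathfrak{a}^{[k/q]}=(\mathfrak{a}^{[k]})^{[1/q]}$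 (well defined). For real $t\ge 0$ and $\mathfrak{a}$ nonzero, $\mathfrak{a}^{[t]}=\bigcup_k\mathfrak{a}^{[t_k]}$, where $(t_k)$ is any sequence of rational numbers with $p$-power denominators converging to $t$ monotonically from above, e.g. $t_k=\lceil p^kt\rceil/p^k$ (independent of the sequence). Test ideals: for $t>0$, $\tau(\mathfrak{a}^t)=\bigcup_{e\ge 0}(\mathfrak{a}^{\lceil tp^e\rceil})^{[1/p^e]}$. For a nonzero proper ideal $\mathfrak{a}$ of $S$: $\operatorname{lce}(\mathfrak{a})=\min\{t>0:\mathfrak{a}^{[t]}\ne S\}$ (least critical exponent) and $\operatorname{fpt}(\mathfrak{a})=\min\{t>0:\tau(\mathfrak{a}^t)\neq S\}$ ($F$-pure threshold). If $\mathfrak{m}_P$ is the maximal ideal of $P$ in $\Bbbk[x_1,\ldots,x_n]$, the $F$-pure threshold of $g$ at $P$ is $\operatorname{fpt}$ of the ideal generated by $g$ in the localization $\Bbbk[x_1,\ldots,x_n]_{\mathfrak{m}_P}$, and the least critical exponent of $\mathfrak{a}$ at $P$ is $\operatorname{lce}$ of the extension of $\mathfrak{a}$ to $\Bbbk[x_1,\ldots,x_n]_{\mathfrak{m}_P}$. *)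

(* Defs.v *)
From HB Require Import structures.
From mathcomp Require Import all_boot all_order all_algebra.
From mathcomp Require Import boolp classical_sets reals.
From mathcomp Require Import mpoly.
Set Implicit Arguments.
Unset Strict Implicit.
Unset Printing Implicit Defensive.
Import Order.TTheory GRing.Theory Num.Theory.
Local Open Scope ring_scope.
Local Open Scope classical_set_scope.

(* Ideals are classical sets. The predicate of mathcomp's ring_quotient.v is
   not used because it excludes the unit ideal. *)
Definition is_ideal (S : comNzRingType) (I : set S) : Prop :=
  [/\ I 0, forall x y, I x -> I y -> I (x + y) & forall a x, I x -> I (a * x)].

Definition ideal_gen (S : comNzRingType) (X : set S) : set S :=
  smallest (@is_ideal S) X.

Definition idealM (S : comNzRingType) (I J : set S) : set S :=
  ideal_gen [set z | exists x y, [/\ I x, J y & z = x * y]].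

Definition idealX (S : comNzRingType) (I : set S) (k : nat) : set S :=
  iter k (idealM I) setT.

(* I^[q]; only used with q a power of the characteristic. *)
Definition frob (S : comNzRingType) (I : set S) (q : nat) : set S :=
  ideal_gen [set f ^+ q | f in I].

(* I^[k] = I^k_0 (I^k_1)^[p] (I^k_2)^[p^2] ..., where k_i is the i-th base p
   digit of k. For p >= 2 all the digits of index > k vanish, so i ranges
   over {0, ..., k}; a zero digit contributes the unit ideal. *)
Definition frob_pow (S : comNzRingType) (p : nat) (I : set S) (k : nat) :
    set S :=
  \big[@idealM S/setT]_(i < k.+1)
     frob (idealX I ((k %/ p ^ i) %% p)%N) (p ^ i)%N.

(* I^[1/q]: the smallest ideal c such that I is contained in c^[q]. *)
Definition frob_root (S : comNzRingType) (I : set S) (q : nat) : set S :=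
  \bigcap_(c in [set c : set S | is_ideal c /\ I `<=` frob c q]) c.

(* The natural number ceil (t * p^e), for t >= 0. *)
Definition ceil_pe (R : realType) (p : nat) (t : R) (e : nat) : nat :=
  `|Num.ceil (t * p%:R ^+ e)|%N.

(* I^[t], computed along the sequence t_e = ceil (t p^e) / p^e, which
   converges to t monotonically from above. *)
Definition frob_real (R : realType) (S : comNzRingType) (p : nat) (I : set S)
    (t : R) : set S :=
  \bigcup_(e in [set: nat]) frob_root (frob_pow p I (ceil_pe p t e)) (p ^ e)%N.

Definition test_ideal (R : realType) (S : comNzRingType) (p : nat)
    (I : set S) (t : R) : set S :=
  \bigcup_(e in [set: nat]) frob_root (idealX I (ceil_pe p t e)) (p ^ e)%N.

Definition is_minimum (R : realType) (A : set R) (c : R) : Prop :=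
  A c /\ forall t, A t -> c <= t.

Definition is_lce (R : realType) (S : comNzRingType) (p : nat) (I : set S)
    (c : R) : Prop :=
  is_minimum [set t : R | 0 < t /\ frob_real p I t <> setT] c.

Definition is_fpt (R : realType) (S : comNzRingType) (p : nat) (I : set S)
    (c : R) : Prop :=
  is_minimum [set t : R | 0 < t /\ test_ideal p I t <> setT] c.

(* For a ring morphism ev : A -> L between integral domains, the localization
   of A at the prime ideal ker ev, as the subring of Frac(A) of the fractions
   whose denominator is not in ker ev. *)
Definition regular_frac (A L : idomainType) (ev : {rmorphism A -> L}) :
    {pred {fraction A}} :=
  fun x => `[< exists a b : A, ev b != 0 /\
                 x = FracField.tofrac a / FracField.tofrac b >].

Lemma regular_fracP (A L : idomainType) (ev : {rmorphism A -> L})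
    (x : {fraction A}) :
  reflect (exists a b : A, ev b != 0 /\
             x = FracField.tofrac a / FracField.tofrac b)
          (x \in regular_frac ev).
Proof. exact: asboolP. Qed.

Lemma tofrac_neq0 (A L : idomainType) (ev : {rmorphism A -> L}) (b : A) :
  ev b != 0 -> FracField.tofrac b != 0.
Proof. by rewrite tofrac_eq0; apply: contraNneq => ->; rewrite rmorph0. Qed.

Lemma regular_frac_tofrac (A L : idomainType) (ev : {rmorphism A -> L})
    (a : A) : FracField.tofrac a \in regular_frac ev.
Proof.
apply/regular_fracP; exists a, 1.
by rewrite rmorph1 oner_neq0 tofrac1 divr1.
Qed.

Fact regular_frac_subring_closed (A L : idomainType)
  (ev : {rmorphism A -> L}) : subring_closed (regular_frac ev).
Proof.
split.
- by rewrite -tofrac1 regular_frac_tofrac.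
- move=> x y /regular_fracP[a [b [b0 ->]]] /regular_fracP[c [d [d0 ->]]].
  apply/regular_fracP; exists (a * d - c * b), (b * d); split.
    by rewrite rmorphM mulf_neq0.
  rewrite tofracB !tofracM -mulNr addf_div ?(tofrac_neq0 b0) ?(tofrac_neq0 d0)//.
  by rewrite mulNr.
- move=> x y /regular_fracP[a [b [b0 ->]]] /regular_fracP[c [d [d0 ->]]].
  apply/regular_fracP; exists (a * c), (b * d); split.
    by rewrite rmorphM mulf_neq0.
  by rewrite !tofracM mulf_div.
Qed.

HB.instance Definition _ (A L : idomainType) (ev : {rmorphism A -> L}) :=
  GRing.isSubringClosed.Build {fraction A} (regular_frac ev)
    (regular_frac_subring_closed ev).

Record localization (A L : idomainType) (ev : {rmorphism A -> L}) :=
  Localization {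
    loc_val : {fraction A};
    loc_valP : loc_val \in regular_frac ev }.

HB.instance Definition _ (A L : idomainType) (ev : {rmorphism A -> L}) :=
  [isSub for @loc_val A L ev].
HB.instance Definition _ (A L : idomainType) (ev : {rmorphism A -> L}) :=
  [Choice of localization ev by <:].
HB.instance Definition _ (A L : idomainType) (ev : {rmorphism A -> L}) :=
  [SubChoice_isSubComNzRing of localization ev by <:].

Definition to_loc (A L : idomainType) (ev : {rmorphism A -> L}) (a : A) :
    localization ev :=
  Localization (regular_frac_tofrac ev a).

(* The kernel of f |-> f(P) is the maximal ideal of the point P. *)
Definition local_ring (K : fieldType) (n : nat) (P : 'I_n -> K) :
    comNzRingType :=
  localization (meval P : {rmorphism {mpoly K[n]} -> K}).

Definition to_local (K : fieldType) (n : nat) (P : 'I_n -> K)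
    (f : {mpoly K[n]}) : local_ring P :=
  to_loc (meval P : {rmorphism {mpoly K[n]} -> K}) f.

Definition extend_local (K : fieldType) (n : nat) (P : 'I_n -> K)
    (I : set {mpoly K[n]}) : set (local_ring P) :=
  ideal_gen (to_local P @` I).
Arguments extend_local {K n} P I _.

Definition is_lce_at (R : realType) (K : fieldType) (n : nat) (p : nat)
    (P : 'I_n -> K) (I : set {mpoly K[n]}) (c : R) : Prop :=
  is_lce p (extend_local P I) c.

Definition is_fpt_at (R : realType) (K : fieldType) (n : nat) (p : nat)
    (P : 'I_n -> K) (g : {mpoly K[n]}) (c : R) : Prop :=
  is_fpt p (ideal_gen [set to_local P g]) c.

Definition zariski_closed (K : fieldType) (m : nat) (Z : set ('I_m -> K)) :
    Prop :=
  exists F : set {mpoly K[m]}, Z = [set x | forall f, F f -> f.@[x] = 0].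

Definition zariski_open (K : fieldType) (m : nat) (U : set ('I_m -> K)) :
    Prop :=
  zariski_closed (~` U).

(* Main.v *)
(* Put f_gamma for the combination sum_i gamma_i g_i, translated so that P is the
   origin, and m for the ideal (x_1, ..., x_n).

   Substituting gamma + t delta for gamma and comparing coefficients of t
   shows that a^[k] lies in an ideal M if and only if (f_gamma)^k lies in M for
   all gamma. In the local ring, a^[t] and tau(f^t) are proper exactly when the
   powers in their definitions lie in m^[p^e] for all e. Hence lce(a) is the
   maximum of the F-pure thresholds c_gamma of the f_gamma.

   For f = f_gamma <> 0, f^k lies in m^[p^e] if and only if c_gamma p^e <= k.
   The numbers x_s = c p^s - ceil(c p^s) + 1 take at most N values, where N
   bounds the dimension of the space of polynomials of the degree of f: taking
   p^e-th roots of f^b with b <= p^e does not increase the degree, and distinct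
   x_s produce linearly independent polynomials in this way. Therefore
   c (p^j - p^i) is an integer for some i < j <= N, and all the c_gamma lie in
   (1/D) Z for one D that does not depend on gamma. So c_gamma is maximal if and
   only if it exceeds some a / p^e just below the maximum, that is, if and only
   if (f_gamma)^a is not in m^[p^e], which is an open condition on gamma. *)
Require Import Defs.
From HB Require Import structures.
From mathcomp Require Import all_boot all_order all_algebra.
From mathcomp Require Import boolp classical_sets reals.
From mathcomp Require Import mpoly.
Set Implicit Arguments.
Unset Strict Implicit.
Unset Printing Implicit Defensive.
Import Order.TTheory GRing.Theory Num.Theory.
Local Open Scope ring_scope.
Local Open Scope classical_set_scope.

(** * Frobenius powers of ideals generated by finitely many elements *)

Lemma ideal_gen_is_ideal (S : comNzRingType) (X : set S) :
  is_ideal (ideal_gen X).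
Proof.
split=> [M [[]]//|x y Ix Iy M MX|a x Ix M MX].
  by case: (MX) => -[_ MD _] _; apply: MD; [apply: Ix|apply: Iy].
by case: (MX) => -[_ _ MM] _; apply: MM; apply: Ix.
Qed.

Lemma ideal_sum (S : comNzRingType) (M : set S) (I : Type) (r : seq I)
    (Q : pred I) (F : I -> S) :
  is_ideal M -> (forall i, Q i -> M (F i)) -> M (\sum_(i <- r | Q i) F i).
Proof. by move=> [M0 MD _] MF; apply: big_ind. Qed.

Lemma ideal_unit (S : comNzRingType) (M : set S) : is_ideal M -> M 1 -> M = setT.
Proof.
by move=> [_ _ MM] M1; apply/seteqP; split=> // x _; rewrite -[x]mulr1; apply: MM.
Qed.

Lemma is_ideal_colon (S : comNzRingType) (M : set S) (z : S) :
  is_ideal M -> is_ideal [set x | M (z * x)].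
Proof.
move=> [M0 MD MM]; split=> /= [|x y Mx My|a x Mx]; first by rewrite mulr0.
  by rewrite mulrDr; apply: MD.
by rewrite mulrCA; apply: MM.
Qed.

Lemma idealM_sub (S : comNzRingType) (I J M : set S) : is_ideal M ->
  (forall x y, I x -> J y -> M (x * y)) -> idealM I J `<=` M.
Proof.
by move=> idM IJM; apply: smallest_sub => // _ [x [y [Ix Jy ->]]]; apply: IJM.
Qed.

Lemma idealMmem (S : comNzRingType) (I J : set S) x y :
  I x -> J y -> idealM I J (x * y).
Proof. by move=> Ix Jy; apply: sub_gen_smallest; exists x, y. Qed.

Section FrobeniusPower.

Variables (p : nat) (S : comNzRingType).
Hypothesis pS : p \in [pchar S].

Lemma exprD_pexp j (x y : S) : (x + y) ^+ (p ^ j) = x ^+ (p ^ j) + y ^+ (p ^ j).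
Proof.
apply: exprDn_pchar; rewrite pnatX (eq_pnat _ (pcharf_eq pS)).
by rewrite pnat_id ?orTb// (pcharf_prime pS).
Qed.

Lemma expr_sum_pexp j (I : Type) (r : seq I) (Q : pred I) (F : I -> S) :
  (\sum_(i <- r | Q i) F i) ^+ (p ^ j) = \sum_(i <- r | Q i) F i ^+ (p ^ j).
Proof.
apply: (big_morph (fun x : S => x ^+ (p ^ j))) => [x y|]; first exact: exprD_pexp.
by rewrite expr0n expn_eq0 -leqn0 leqNgt prime_gt0 ?(pcharf_prime pS).
Qed.

Variables (K : closedFieldType) (s : {rmorphism K -> S}).

Let p_prime : prime p. Proof. exact: pcharf_prime pS. Qed.

Let pK : p \in [pchar K].
Proof.
by rewrite inE p_prime /= -(fmorph_eq0 s) rmorph_nat (pcharf0 pS).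
Qed.

(** An algebraically closed field is infinite: adding 1 to a multiple of the product of the
    ['X - z%:P] yields a polynomial whose roots avoid [r]. The extra factor ['X] keeps it
    nonconstant when [r] is empty. *)
Lemma closed_field_injection k : exists t : 'I_k -> K, injective t.
Proof.
suff [r r_uniq r_size] : exists2 r : seq K, uniq r & size r = k.
  exists (fun i => r`_i) => i j /eqP; rewrite nth_uniq ?r_size//.
  by move/eqP/val_inj.
elim: k => [|k [r r_uniq r_size]]; first by exists [::].
have /closed_rootP[x] : size (\prod_(z <- r) ('X - z%:P) * 'X + 1%:P) != 1%N.
  rewrite size_MXaddC oner_eq0 andbF size_prod_XsubC.
  by [].
rewrite rootE hornerD hornerM hornerX hornerC => rx.
exists (x :: r); last by rewrite /= r_size.
rewrite /= r_uniq andbT; apply: contraTN rx => xr.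
rewrite (_ : _.[x] = 0) ?mul0r ?add0r ?oner_eq0//.
by apply/eqP; rewrite -rootE root_prod_XsubC.
Qed.

(** The Vandermonde matrix of the distinct [t j] is invertible over [K], so each [z i] is a
    combination of the values assumed to be in [M]. *)
Lemma poly_coef_mem (M : set S) k (t : 'I_k -> K) (z : 'I_k -> S) :
  is_ideal M -> injective t ->
  (forall j, M (\sum_(i < k) s (t j ^+ i) * z i)) -> forall i, M (z i).
Proof.
move=> idM t_inj Mz i; pose V := Vandermonde k (\row_j t j).
have V_unit : V \in unitmx.
  rewrite unitmxE det_Vandermonde unitfE; apply/prodf_neq0 => a _.
  apply/prodf_neq0 => b ab; rewrite !mxE subr_eq0.
  by apply: contraTneq ab => /t_inj ->; rewrite ltnn.
have -> : z i = \sum_j s (invmx V j i) * \sum_(l < k) s (t j ^+ l) * z l.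
  under eq_bigr do rewrite mulr_sumr.
  have VW (l : 'I_k) :
      \sum_j s (invmx V j i) * (s (t j ^+ l) * z l) = (l == i)%:R * z l.
    under eq_bigr do rewrite mulrA -rmorphM.
    rewrite -mulr_suml -rmorph_sum /= (_ : \sum_j _ = (V *m invmx V) l i).
      by rewrite mulmxV// mxE rmorph_nat.
    rewrite mxE; apply: eq_bigr => j _; rewrite mulrC; congr (_ * _).
    by rewrite !mxE.
  rewrite exchange_big /= (bigD1 i)//= VW eqxx mul1r big1 ?addr0// => l li.
  by rewrite VW (negPf li) mul0r.
by apply: ideal_sum => // j _; case: idM => _ _; apply.
Qed.

Lemma injective_pexp j : injective (fun x : K => x ^+ (p ^ j)).
Proof.
move=> x y /= xy; apply/eqP; rewrite -subr_eq0.
have /eqP : (x - y) ^+ (p ^ j) = 0.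
  apply: (addIr (y ^+ (p ^ j))); rewrite add0r -exprDn_pchar ?subrK//.
  rewrite pnatX (eq_pnat _ (pcharf_eq pK)).
  by rewrite pnat_id ?orTb.
by rewrite expf_eq0 => /andP[].
Qed.

Variables (m : nat) (g : 'I_m -> S).

Let lin (c : 'I_m -> K) : S := \sum_i s (c i) * g i.

(* Expand [(lin c + t lin d)^(p^j k) = ((lin c)^(p^j) + t^(p^j) (lin d)^(p^j))^k]
   in powers of [t]: the linear coefficient is a nonzero multiple [k] of the
   element below. *)
Lemma lin_polarize (M : set S) j k c d : is_ideal M -> ~~ (p %| k.+1)%N ->
  (forall c, M (lin c ^+ (p ^ j * k.+1))) ->
  M (lin d ^+ (p ^ j) * lin c ^+ (p ^ j * k)).
Proof.
move=> idM pk Mlin; set q := (p ^ j)%N.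
have [t t_inj] := closed_field_injection k.+2.
pose z (i : 'I_k.+2) :=
  lin c ^+ q ^+ (k.+1 - i) * lin d ^+ q ^+ i *+ 'C(k.+1, i).
have Mz : M (z (lift ord0 ord0)).
  apply: (poly_coef_mem (t := fun i => t i ^+ q) (z := z) idM).
    by move=> a b /injective_pexp/t_inj.
  move=> a.
  have -> : \sum_(i < k.+2) s ((t a ^+ q) ^+ i) * z i
    = lin (fun i => c i + t a * d i) ^+ (q * k.+1).
    have -> : lin (fun i => c i + t a * d i) = lin c + s (t a) * lin d.
      rewrite /lin mulr_sumr -big_split /=; apply: eq_bigr => i _.
      by rewrite rmorphD rmorphM mulrDl mulrA.
    rewrite exprM exprD_pexp exprDn; apply: eq_bigr => i _.
    by rewrite /z !exprMn !rmorphXn /= mulrnAr mulrCA.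
  exact: Mlin.
have k_neq0 : k.+1%:R != 0 :> K by rewrite -(dvdn_pcharf pK).
move: Mz; rewrite /z /= /bump /= addn0 subn1 /= bin1 expr1 => Mz.
have [_ _ MM] := idM.
have := MM (s (k.+1%:R^-1)) _ Mz.
rewrite -[_ * _ *+ _]mulr_natl mulrA -(rmorph_nat s) -rmorphM mulVf// rmorph1 mul1r.
by rewrite mulrC -exprM.
Qed.

Let I := ideal_gen (range g).

(** Induction on the number of digits: the lowest digit of [k] is stripped off and the rest is
    treated with [j.+1]. [M] stays general because it gets replaced by colon ideals. *)
Lemma bigM_frob_sub L (M : set S) j k : is_ideal M -> (k < p ^ L)%N ->
  (forall c, M (lin c ^+ (p ^ j * k))) ->
  \big[@idealM S/setT]_(i < L)
     frob (idealX I ((k %/ p ^ i) %% p)%N) (p ^ (j + i))%N `<=` M.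
Proof.
elim: L M j k => [|L IHL] M j k idM; rewrite ?expn0.
  rewrite ltnS leqn0 => /eqP -> /(_ (fun=> 0)); rewrite muln0 expr0 => M1.
  by rewrite big_ord0 (ideal_unit idM M1).
move=> kp Mlin; rewrite big_ord_recl /=.
have -> : \big[@idealM S/setT]_(i < L)
     frob (idealX I ((k %/ p ^ bump 0 i) %% p)%N) (p ^ (j + bump 0 i))%N =
  \big[@idealM S/setT]_(i < L)
     frob (idealX I ((k %/ p %/ p ^ i) %% p)%N) (p ^ (j.+1 + i))%N.
  by apply: eq_bigr => i _; rewrite /bump add1n -divnMA -expnS addSnnS.
set B := \big[_/_]_(i < L) _.
have kpL : (k %/ p < p ^ L)%N by rewrite ltn_divLR ?prime_gt0// -expnSr.
(* One generator [g i] at a time is split off [z]: by [lin_polarize], [N] may be replaced by its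
   colon by [g i ^+ (p ^ j)] while [a] drops by one. *)
have IB a z N : (a < p)%N -> is_ideal N -> idealX I a z ->
    (forall c, N (lin c ^+ (p ^ j * (k %/ p * p + a)))) ->
    B `<=` [set y | N (z ^+ (p ^ j) * y)].
  elim: a N z => [|a IHa] N z ap idN Iz Nlin.
    move=> y By; have [_ _ NM] := idN; apply: NM; apply: (IHL N j.+1 _ _ kpL) => //.
    by move=> c; rewrite expnSr -mulnA [(p * _)%N]mulnC -[(_ * p)%N]addn0.
  suff : idealX I a.+1 `<=` [set z | B `<=` [set y | N (z ^+ (p ^ j) * y)]].
    by move/(_ _ Iz).
  have idB : is_ideal [set z | B `<=` [set y | N (z ^+ (p ^ j) * y)]].
    split=> [y By|x y Bx By w Bw|b x Bx w Bw] /=.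
    - rewrite expr0n expn_eq0 -leqn0 leqNgt prime_gt0//= mul0r.
      by case: idN.
    - rewrite exprD_pexp mulrDl; case: idN => _ ND _; apply: ND.
        exact: Bx.
      exact: By.
    - by rewrite exprMn -mulrA; case: idN => _ _; apply; apply: Bx.
  apply: idealM_sub => // x y Ix.
  rewrite -/(idealX I a) => Iy w Bw /=.
  suff : I `<=` [set x | N ((x * y) ^+ (p ^ j) * w)] by move/(_ _ Ix).
  apply: smallest_sub.
    split=> /= [|u v|b u].
    - rewrite mul0r expr0n expn_eq0 -leqn0 leqNgt prime_gt0//= mul0r.
      by case: idN.
    - by rewrite mulrDl exprD_pexp mulrDl; case: idN => _ ND _; apply: ND.
    - by move=> Nu; rewrite -mulrA exprMn -mulrA; case: idN => _ _; apply.
  move=> _ [i _ <-] /=; rewrite exprMn -mulrA.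
  apply: (IHa [set v | N (g i ^+ (p ^ j) * v)]) => //.
  - exact: ltnW.
  - exact: is_ideal_colon.
  - move=> c /=.
    have -> : g i = lin (fun l => (l == i)%:R).
      rewrite /lin (bigD1 i)//= eqxx rmorph1 mul1r big1 ?addr0// => l li.
      by rewrite (negPf li) rmorph0 mul0r.
    (* Since [0 < a.+1 < p], the exponent [k %/ p * p + a.+1] is prime to [p]; this is where base
       [p] digits matter. *)
    apply: lin_polarize => //; last by move=> c'; rewrite -addnS.
    by rewrite -addnS dvdn_addr ?dvdn_mull// gtnNdvd.
apply: idealM_sub => // x y Fx By.
suff : frob (idealX I (k %/ p ^ 0 %% p)) (p ^ (j + 0)) `<=` [set x | M (y * x)].
  by move/(_ _ Fx); rewrite /= mulrC.
apply: smallest_sub; first exact: is_ideal_colon.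
move=> _ [z Iz <-] /=; rewrite addn0 mulrC.
move: Iz; rewrite expn0 divn1 => Iz; apply: (IB _ _ _ _ idM Iz _ _ By) => [|c].
  by rewrite ltn_pmod ?prime_gt0.
by rewrite -divn_eq.
Qed.

Lemma lin_idealX c k : idealX I k (lin c ^+ k).
Proof.
elim: k => [|k IHk]; first by rewrite expr0.
rewrite exprS; apply: idealMmem => //.
apply: ideal_sum => [|i _]; first exact: ideal_gen_is_ideal.
have [_ _ IM] := ideal_gen_is_ideal (range g).
by apply: IM; apply: sub_gen_smallest; exists i.
Qed.

Lemma lin_bigM_frob L c j k : (k < p ^ L)%N ->
  (\big[@idealM S/setT]_(i < L)
     frob (idealX I ((k %/ p ^ i) %% p)%N) (p ^ (j + i))%N) (lin c ^+ (p ^ j * k)).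
Proof.
elim: L j k => [|L IHL] j k; first by rewrite big_ord0.
move=> kp; rewrite big_ord_recl /=.
have kpL : (k %/ p < p ^ L)%N by rewrite ltn_divLR ?prime_gt0// -expnSr.
have -> : lin c ^+ (p ^ j * k) =
    (lin c ^+ (k %% p)) ^+ (p ^ j) * lin c ^+ (p ^ j.+1 * (k %/ p)).
  rewrite -exprM -exprD {1}(divn_eq k p) mulnDr addnC [(k %% p * _)%N]mulnC.
  by rewrite expnSr -mulnA [(p * _)%N]mulnC.
apply: idealMmem.
  rewrite addn0 expn0 divn1; apply: sub_gen_smallest.
  by exists (lin c ^+ (k %% p)) => //; apply: lin_idealX.
have := IHL j.+1 _ kpL; set A := \big[_/_]_(i < L) _; set B := \big[_/_]_(i < L) _.
suff -> : A = B by [].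
by apply: eq_bigr => i _; rewrite /bump add1n -divnMA -expnS addSnnS.
Qed.

(** This reduces the Frobenius power of [I] to powers of single combinations, and so the least
    critical exponent to thresholds of polynomials. As [k < p ^ k.+1], the product in [frob_pow]
    covers every digit. *)
Lemma frob_pow_subP (M : set S) k : is_ideal M ->
  frob_pow p I k `<=` M <-> forall c, M (lin c ^+ k).
Proof.
have kp : (k < p ^ k.+1)%N.
  apply: leq_trans (ltn_expl _ (prime_gt1 p_prime)) _.
  by rewrite leq_exp2l ?prime_gt1.
move=> idM; split=> [IM c|Mlin]; last first.
  apply: (bigM_frob_sub (j := 0) idM kp) => c.
  by rewrite expn0 mul1n.
by apply: IM; have := lin_bigM_frob c 0 kp; rewrite expn0 mul1n.
Qed.

End FrobeniusPower.

(** * Frobenius powers of the ideal of the origin *)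

(* The [q]-th Frobenius power [(x_1^q, ..., x_n^q)] of the ideal of the origin. *)
Definition monom_pow (K : fieldType) (n q : nat) : set {mpoly K[n]} :=
  [set h | forall a : 'X_{1..n}, (forall i, a i < q)%N -> h@_a = 0].

(* The component of [h] along [x^u] in the basis of the monomials over the ring
   of polynomials in [x_i^q]; its coefficients are not replaced by their
   [q]-th roots, hence the Frobenius twist in [kappa_expM]. *)
Definition kappa (K : fieldType) (n q : nat) (u : 'X_{1..n}) (h : {mpoly K[n]}) :
    {mpoly K[n]} :=
  \sum_(a : 'X_{1..n < msize h}) h@_((a : 'X_{1..n}) *+ q + u)%MM *: 'X_[a].

Lemma mcoeffXM (K : fieldType) (n : nat) (h : {mpoly K[n]}) (m k : 'X_{1..n}) :
  ('X_[m] * h)@_k = if (m <= k)%MM then h@_(k - m) else 0.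
Proof.
rewrite mulrC; case: ifPn => [mk|mk].
  by rewrite -{1}(submK mk) addmC mcoeffMX.
apply/eqP; rewrite mcoeff_eq0 (perm_mem (msuppMX _ _)).
by apply: contra mk => /mapP[a _ ->]; rewrite lem_addr.
Qed.

Lemma is_ideal_monom_pow (K : fieldType) (n q : nat) :
  is_ideal (@monom_pow K n q).
Proof.
split=> [a _|x y Mx My a aq|x y My a aq]; first by rewrite mcoeff0.
  by rewrite mcoeffD Mx// My// addr0.
rewrite mcoeffM big1// => k /eqP ak; rewrite My ?mulr0// => i.
by apply: leq_ltn_trans (aq i); move/mnmP: ak => ->; rewrite mnmDE leq_addl.
Qed.

Lemma monom_powZ (K : fieldType) (n q : nat) c (h : {mpoly K[n]}) :
  monom_pow q h -> monom_pow q (c *: h).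
Proof. by move=> Mh a aq; rewrite mcoeffZ Mh// mulr0. Qed.

Lemma notin_monom_pow (K : fieldType) (n q : nat) (h : {mpoly K[n]}) :
  ~ monom_pow q h -> exists2 a : 'X_{1..n}, (forall i, a i < q)%N & h@_a != 0.
Proof.
move=> /existsNP[a /not_implyP[aq /eqP ha]].
by exists a.
Qed.

(** Truncating at [msize h] loses nothing: for [q > 0] the degree of [a *+ q + u] is at least that
    of [a]. *)
Lemma mcoeff_kappa (K : fieldType) (n q : nat) (u : 'X_{1..n}) (h : {mpoly K[n]})
    (a : 'X_{1..n}) : (0 < q)%N -> (kappa q u h)@_a = h@_(a *+ q + u)%MM.
Proof.
move=> q0; have [ah|ha] := ltnP (mdeg a) (msize h).
  by rewrite (mcoeff_mpoly (fun a => h@_(a *+ q + u)%MM)).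
rewrite raddf_sum big1 => [|b _]; last first.
  rewrite /= mcoeffZ mcoeffX; case: eqP => [ba|]; last by rewrite mulr0.
  by move: (bmdeg b); rewrite ba ltnNge ha.
apply/esym/eqP; rewrite mcoeff_eq0; apply: msize_mdeg_ge.
rewrite (leq_trans ha)// mdegD mdegMn (leq_trans _ (leq_addr _ _))//.
by rewrite leq_pmulr.
Qed.

Lemma kappa_sum (K : fieldType) (n q : nat) (u : 'X_{1..n}) (I : Type) (r : seq I)
    (F : I -> {mpoly K[n]}) : (0 < q)%N ->
  kappa q u (\sum_(i <- r) F i) = \sum_(i <- r) kappa q u (F i).
Proof.
move=> q0; apply/mpolyP => a; rewrite mcoeff_kappa// !raddf_sum /=.
by apply: eq_bigr => i _; rewrite mcoeff_kappa.
Qed.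

Lemma kappaZ (K : fieldType) (n q : nat) (u : 'X_{1..n}) c (h : {mpoly K[n]}) :
  (0 < q)%N -> kappa q u (c *: h) = c *: kappa q u h.
Proof.
by move=> q0; apply/mpolyP => a; rewrite mcoeffZ !mcoeff_kappa// mcoeffZ.
Qed.

Lemma lepm_mulD (n q : nat) (m a u : 'X_{1..n}) : (forall i, u i < q)%N ->
  (m *+ q <= a *+ q + u)%MM = (m <= a)%MM.
Proof.
move=> uq; apply/mnm_lepP/mnm_lepP => ma i; move: (ma i);
    rewrite mnmDE !mulmnE.
  have q0 : (0 < q)%N by apply: leq_ltn_trans (uq i).
  move=> mq; rewrite -ltnS -(ltn_pmul2r q0); apply: leq_ltn_trans mq _.
  by rewrite mulSn addnC ltn_add2r.
by move=> mai; rewrite (leq_trans _ (leq_addr _ _))// leq_mul2r mai orbT.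
Qed.

Lemma submMnD (n q : nat) (m a u : 'X_{1..n}) : (m <= a)%MM ->
  (a *+ q + u - m *+ q)%MM = ((a - m) *+ q + u)%MM.
Proof.
move/mnm_lepP => ma; apply/mnmP => i; rewrite !mnmE !mulmnE !mnmE.
by rewrite mulnBl -addnBAC// leq_mul2r ma orbT.
Qed.

Lemma kappaXM (K : fieldType) (n q : nat) (u m : 'X_{1..n}) (h : {mpoly K[n]}) :
  (forall i, u i < q)%N -> (0 < q)%N ->
  kappa q u ('X_[m *+ q] * h) = 'X_[m] * kappa q u h.
Proof.
move=> uq q0; apply/mpolyP => a; rewrite mcoeff_kappa// !mcoeffXM lepm_mulD//.
by case: ifP => // ma; rewrite mcoeff_kappa// submMnD.
Qed.

(** Euclidean division by [q] in each coordinate: the entries of [b *+ q + u], with those of [u]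
    below [q], are below [Q * q] exactly when those of [b] are below [Q]. *)
Lemma monom_pow_kappaP (K : fieldType) (n q Q : nat) (h : {mpoly K[n]}) :
  (0 < q)%N -> monom_pow (Q * q) h <->
  forall u : 'X_{1..n}, (forall i, u i < q)%N -> monom_pow Q (kappa q u h).
Proof.
move=> q0; split=> [Mh u uq a aQ|Mh a aQ].
  rewrite mcoeff_kappa// Mh// => i; rewrite mnmDE mulmnE.
  by apply: (@leq_trans ((a i).+1 * q)); rewrite ?leq_mul2r ?aQ ?orbT// mulSn
    addnC ltn_add2r.
pose u := [multinom (a i %% q)%N | i < n].
pose b := [multinom (a i %/ q)%N | i < n].
have -> : a = (b *+ q + u)%MM.
  by apply/mnmP => i; rewrite mnmDE mulmnE !mnmE -divn_eq.
rewrite -mcoeff_kappa// Mh// => i; rewrite mnmE; first by rewrite ltn_mod.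
by rewrite ltn_divLR.
Qed.

(** The degree of [f ^+ b] is at most [q] times that of [f], and passing to a component divides this
    bound by [q]. *)
Lemma msize_kappa (K : fieldType) (n q b d : nat) (u : 'X_{1..n})
    (f : {mpoly K[n]}) : (msize f <= d)%N -> (b <= q)%N -> (0 < q)%N ->
  f != 0 -> (msize (kappa q u (f ^+ b)) <= d)%N.
Proof.
move=> fd bq q0 f0; have f_gt0 : (0 < msize f)%N by rewrite lt0n msize_poly_eq0.
rewrite msizeE; apply/bigmax_leqP_seq => a; rewrite mcoeff_msupp mcoeff_kappa//.
rewrite -mcoeff_msupp => /msize_mdeg_lt; rewrite mdegD mdegMn => af _.
have fb k : (msize (f ^+ k) <= k * (msize f).-1 + 1)%N.
  elim: k => [|k IHk]; first by rewrite expr0 msize1.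
  rewrite exprS msizeM ?expf_neq0// mulSn -addnA.
  case: (msize f) f_gt0 IHk => // s _.
  by rewrite addSn /= => IHk; rewrite leq_add2l.
have {}af : (mdeg a * q < q * (msize f).-1 + 1)%N.
  apply: leq_trans (leq_ltn_trans (leq_addr _ _) af) _.
  by rewrite (leq_trans (fb b))// leq_add2r leq_mul2r bq orbT.
move: af; rewrite addn1 ltnS mulnC leq_pmul2l// => af.
by rewrite (leq_trans _ fd)// -(prednK f_gt0).
Qed.

Section PositiveCharacteristic.

Variables (K : fieldType) (n p : nat).
Hypothesis pK : p \in [pchar K].
Implicit Types (f h : {mpoly K[n]}).

Let p_prime : prime p. Proof. exact: pcharf_prime pK. Qed.

Let pA : p \in [pchar {mpoly K[n]}].
Proof. exact: (rmorph_pchar (@mpolyC n K)). Qed.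

Let pexp_gt0 e : (0 < p ^ e)%N. Proof. by rewrite expn_gt0 prime_gt0. Qed.

Lemma expr_pexp_mpoly e h :
  h ^+ (p ^ e) = \sum_(m <- msupp h) (h@_m ^+ (p ^ e)) *: 'X_[m *+ (p ^ e)].
Proof.
rewrite {1}[h]mpolyE (expr_sum_pexp pA); apply: eq_bigr => m _.
by rewrite exprZn mpolyXn.
Qed.

(** [kappa] is linear over the polynomials in the [x_i^(p^e)], and [h ^+ (p ^ e)] is one of them. *)
Lemma kappa_expM e (u : 'X_{1..n}) h f : (forall i, u i < p ^ e)%N ->
  kappa (p ^ e) u (h ^+ (p ^ e) * f) =
  kappa (p ^ e) 0%MM (h ^+ (p ^ e)) * kappa (p ^ e) u f.
Proof.
move=> uq; rewrite expr_pexp_mpoly mulr_suml !kappa_sum// mulr_suml.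
apply: eq_bigr => m _; rewrite -scalerAl !kappaZ// -scalerAl; congr (_ *: _).
rewrite kappaXM// -[X in kappa _ 0%MM X]mulr1 kappaXM//.
  congr (_ * _); rewrite -[LHS]mulr1; congr (_ * _).
  apply/mpolyP => a; rewrite mcoeff_kappa// !mcoeff1 addm0.
  congr ((nat_of_bool _)%:R); apply/eqP/eqP => [->|].
    by apply/mnmP => i; rewrite mulmnE mnmE.
  move=> /mnmP a0; apply/mnmP => i; have /eqP := a0 i.
  by rewrite mulmnE mnmE muln_eq0 (gtn_eqF (pexp_gt0 e)) orbF => /eqP.
by move=> i; rewrite mnmE.
Qed.

(** Only the monomial [a] of [h] contributes: any other would require a monomial of [f] of degree at
    least [p ^ e]. *)
Lemma mcoeff_expM e h f (a b : 'X_{1..n}) :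
  (msize f <= p ^ e)%N -> (forall i, b i < p ^ e)%N ->
  (h ^+ (p ^ e) * f)@_(a *+ (p ^ e) + b)%MM = h@_a ^+ (p ^ e) * f@_b.
Proof.
move=> fq bq; rewrite expr_pexp_mpoly mulr_suml raddf_sum /=.
have E m : (h@_m ^+ (p ^ e) *: 'X_[m *+ (p ^ e)] * f)@_(a *+ (p ^ e) + b)%MM =
    (m == a)%:R * (h@_a ^+ (p ^ e) * f@_b).
  rewrite -scalerAl mcoeffZ mcoeffXM lepm_mulD//; case: eqP => [->|/eqP ma].
    by rewrite lepm_refl addmC addmK mul1r.
  case: ifP => [lema|_]; last by rewrite mulr0 mul0r.
  rewrite submMnD// (_ : f@__ = 0) ?mulr0 ?mul0r//; apply/eqP.
  rewrite mcoeff_eq0; apply: msize_mdeg_ge; rewrite (leq_trans fq)//.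
  rewrite mdegD mdegMn (leq_trans _ (leq_addr _ _))// leq_pmull//.
  rewrite lt0n mdeg_eq0; apply: contra ma => /eqP am.
  by rewrite -[a](submK lema) am add0m.
under eq_bigr do rewrite E.
have [ha|ha] := boolP (a \in msupp h).
  rewrite (bigD1_seq a)//= eqxx mul1r big1 ?addr0// => m /negPf ->.
  by rewrite mul0r.
rewrite big_seq big1 => [|m mh].
  move: ha; rewrite -mcoeff_eq0 => /eqP ->.
  by rewrite expr0n (gtn_eqF (pexp_gt0 e)) mul0r.
by case: eqP => [ma|]; [rewrite -ma mh in ha|rewrite mul0r].
Qed.

Lemma monom_pow_exp e q h :
  monom_pow (q * p ^ e) (h ^+ (p ^ e)) <-> monom_pow q h.
Proof.
split=> [Mh a aq|Mh].
  have := Mh (a *+ (p ^ e) + 0)%MM; rewrite -[h ^+ _]mulr1 mcoeff_expM.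
  - rewrite mcoeff1 eqxx mulr1 => ha; apply/eqP.
    have : h@_a ^+ (p ^ e) == 0.
      by rewrite ha// => i; rewrite addm0 mulmnE ltn_pmul2r.
    by rewrite expf_eq0 pexp_gt0.
  - by rewrite msize1.
  - by move=> i; rewrite mnmE.
rewrite expr_pexp_mpoly big_seq.
apply: ideal_sum => [|m mh]; first exact: is_ideal_monom_pow.
apply: monom_powZ => a aq; rewrite mcoeffX; case: eqP => // ma.
move: mh; rewrite mcoeff_msupp Mh ?eqxx// => i.
by have := aq i; rewrite -ma mulmnE ltn_pmul2r.
Qed.

(** Once [p ^ e] exceeds the size of [f], a monomial of [h] outside the ideal and any monomial of
    [f] combine, by [mcoeff_expM], into a monomial of the product outside the larger power. *)
Lemma notin_monom_pow_expM q h f : f != 0 -> ~ monom_pow q h ->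
  exists e, ~ monom_pow (q * p ^ e) (h ^+ (p ^ e) * f).
Proof.
move=> f0 /notin_monom_pow[a aq ha].
have [b fb] : exists b, f@_b != 0.
  by exists (mlead f); rewrite mleadc_eq0.
exists (msize f) => M.
have fq : (msize f < p ^ msize f)%N by apply: ltn_expl; apply: prime_gt1.
have bq i : (b i < p ^ msize f)%N.
  apply: leq_ltn_trans fq; have : (mdeg b < msize f)%N.
    by apply: msize_mdeg_lt; rewrite mcoeff_msupp.
  by rewrite mdegE (bigD1 i)//= => /ltnW; apply: leq_trans; rewrite leq_addr.
have := M (a *+ (p ^ msize f) + b)%MM; rewrite mcoeff_expM//; last exact: ltnW.
have /negP h0 : h@_a ^+ (p ^ msize f) * f@_b != 0 by rewrite mulf_neq0// expf_neq0.
move=> M0; apply: h0; apply/eqP; apply: M0 => i; rewrite mnmDE mulmnE.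
apply: (@leq_trans ((a i).+1 * p ^ msize f)); rewrite ?leq_mul2r ?aq ?orbT//.
by rewrite mulSn addnC ltn_add2r.
Qed.

Lemma monom_pow_le q h k l : (k <= l)%N ->
  monom_pow q (h ^+ k) -> monom_pow q (h ^+ l).
Proof.
move=> kl Mk; rewrite -(subnK kl) exprD.
by have [_ _] := is_ideal_monom_pow K n q; apply.
Qed.

End PositiveCharacteristic.

(** * Thresholds of a polynomial at the origin *)

(** [c] is the supremum of the ratios [k / p^e] for which [f ^+ k] is outside
    [monom_pow (p ^ e)]. *)
Lemma threshold_exists (R : realType) (K : fieldType) (n p : nat)
    (f : {mpoly K[n]}) : p \in [pchar K] -> f != 0 -> monom_pow 1 f ->
  exists c : R, [/\ 0 < c, c <= 1 &
    forall k e, monom_pow (p ^ e) (f ^+ k) <-> c * p%:R ^+ e <= k%:R].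
Proof.
move=> pK f0 Mf; have p_prime := pcharf_prime pK.
have p0 e : 0 < p%:R ^+ e :> R by rewrite exprn_gt0// ltr0n prime_gt0.
pose E := [set x : R | exists k e,
  ~ monom_pow (p ^ e) (f ^+ k) /\ x = k%:R / p%:R ^+ e].
have bad0 : ~ monom_pow (p ^ 0) (f ^+ 0).
  move/(_ 0%MM) => M0; have /eqP : (f ^+ 0)@_0 = 0 by apply: M0 => i; rewrite mnmE.
  by rewrite expr0 mcoeff1 eqxx oner_eq0.
have E1 x : E x -> x <= 1.
  move=> [k [e [kbad ->]]]; rewrite ler_pdivrMr// mul1r -natrX ler_nat.
  rewrite leqNgt; apply/negP => /ltnW ek; apply: kbad; apply: monom_pow_le ek _.
  by rewrite -[X in monom_pow X _]mul1n; apply/monom_pow_exp.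
have Esup : has_sup E by split; [exists (0%:R / p%:R ^+ 0), 0, 0|exists 1 => x /E1].
(* The supremum is not attained: after a large Frobenius power, one more factor [f] still leaves the
   element outside the ideal and raises the ratio. *)
have bad_lt k e : ~ monom_pow (p ^ e) (f ^+ k) -> k%:R / p%:R ^+ e < sup E.
  move=> /(notin_monom_pow_expM pK f0)[r].
  rewrite -exprM -exprSr -expnD => kbad.
  apply: (@lt_le_trans _ _ ((k * p ^ r).+1%:R / p%:R ^+ (e + r))).
    rewrite ltr_pdivrMr// mulrAC ltr_pdivlMr// -!natrX -!natrM ltr_nat.
    by rewrite expnD mulnCA mulnC ltn_pmul2r ?expn_gt0 ?prime_gt0.
  by apply: sup_ubound; [case: Esup|exists (k * p ^ r).+1, (e + r)%N].
exists (sup E); split.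
- by have := bad_lt _ _ bad0; rewrite mul0r.
- by apply: ge_sup => //; case: Esup.
- move=> k e; split=> [kgood|]; last first.
    rewrite leNgt -ltr_pdivrMr// => /negP ck; apply: contra_notP ck.
    exact: bad_lt.
  rewrite -ler_pdivlMr//; apply: ge_sup; first by case: Esup.
  move=> _ [l [d [lbad ->]]]; rewrite ler_pdivrMr// mulrAC ler_pdivlMr//.
  rewrite -!natrX -!natrM ler_nat leqNgt; apply/negP => kl; apply: lbad.
  apply/(monom_pow_exp pK e); rewrite -exprM -expnD.
  apply: monom_pow_le (ltnW kl) _.
  by rewrite addnC expnD exprM; apply/(monom_pow_exp pK d).
Qed.

(** * Bounded denominators of the thresholds *)

Lemma mpoly_lindep (K : fieldType) (n d : nat)
    (v : 'I_#|{: 'X_{1..n < d}}|.+1 -> {mpoly K[n]}) :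
  (forall s, msize (v s) <= d)%N ->
  exists2 l, \sum_s l s *: v s = 0 & exists s, l s != 0.
Proof.
move=> vd; set N := #|_|.
pose A : 'M[K]_(N.+1, N) := \matrix_(s, j) (v s)@_(enum_val j : 'X_{1..n < d}).
have : kermx A != 0.
  by rewrite kermx_eq0 -row_leq_rank -ltnNge ltnS rank_leq_col.
move/rowV0Pn => [l /sub_kermxP lA l0]; exists (l 0); last first.
  by apply/existsP; apply: contraNT l0; rewrite negb_exists => /forallP l0;
    apply/eqP/rowP => s; rewrite mxE; apply/eqP; rewrite -[_ == _]negbK.
apply/mpolyP => a; rewrite raddf_sum mcoeff0 /=.
have [ad|da] := ltnP (mdeg a) d; last first.
  rewrite big1// => s _; rewrite mcoeffZ (_ : (v s)@_a = 0) ?mulr0//.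
  by apply/eqP; rewrite mcoeff_eq0; apply: msize_mdeg_ge; apply: leq_trans da.
have := congr1 (fun B : 'rV_N => B 0 (enum_rank (BMultinom ad))) lA.
rewrite mxE [X in _ = X]mxE => lA0; rewrite -[RHS]lA0; apply: eq_bigr => s _.
by rewrite mcoeffZ mxE enum_rankK.
Qed.

Lemma ceil_nat (R : realType) (t : R) k : 0 <= t ->
  (`|Num.ceil t|%N <= k)%N = (t <= k%:R).
Proof.
move=> t0; rewrite -lez_nat gez0_abs ?ceil_ge0 ?(lt_le_trans _ t0) ?ltrN10//.
by rewrite ceil_le_int.
Qed.

(* Let [nu_s = ceil (c p^s) - 1] and [x_s = c p^s - nu_s], a number in ]0, 1].
   If [x_0, ..., x_N] were distinct, choose [q = p^e] large and integers [b_s]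
   such that [b_s / q] is just below [x_s]. Some component of [f^(b_s)] along
   the free basis of monomials over the subring of [q]-th powers lies outside
   the colon ideal [((x_1^(p^s), ..., x_n^(p^s)) : f^(nu_s))] (up to a Frobenius
   twist), while it lies in the corresponding ideal for [s'] as soon as
   [x_s' < x_s]. So these components are linearly independent; but there are
   [N + 1] of them in a space of dimension [N]. *)
Lemma threshold_periodic (R : realType) (K : fieldType) (n p d : nat)
    (f : {mpoly K[n]}) (c : R) :
  p \in [pchar K] -> f != 0 -> (msize f <= d)%N -> 0 < c ->
  (forall k e, monom_pow (p ^ e) (f ^+ k) <-> c * p%:R ^+ e <= k%:R) ->
  exists i j : 'I_#|{: 'X_{1..n < d}}|.+1, (i < j)%N /\
    exists z : nat, c * (p ^ j - p ^ i)%:R = z%:R.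
Proof.
move=> pK f0 fd c0 cE; have p_prime := pcharf_prime pK; set N := #|_|.
have p0 e : 0 < p%:R ^+ e :> R by rewrite exprn_gt0// ltr0n prime_gt0.
have low (t : R) : 0 < t -> exists a : nat, a%:R < t <= a%:R + 1.
  move=> t0.
  have ct0 : (0 < `|Num.ceil t|)%N by rewrite ltnNge (ceil_nat _ (ltW t0)) -ltNge.
  exists `|Num.ceil t|%N.-1; rewrite ltNge -(ceil_nat _ (ltW t0)) -ltnNge.
  rewrite natr1 !prednK// leqnn/=.
  by rewrite -(ceil_nat _ (ltW t0)).
have /choice[nu nuP] s : exists a : nat, a%:R < c * p%:R ^+ s <= a%:R + 1.
  by apply: low; rewrite mulr_gt0.
pose x s := c * p%:R ^+ s - (nu s)%:R.
have x_gt0 s : 0 < x s by rewrite subr_gt0; case/andP: (nuP s).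
have x_le1 s : x s <= 1 by rewrite lerBlDl; case/andP: (nuP s).
have good s e b : monom_pow (p ^ s * p ^ e) ((f ^+ nu s) ^+ (p ^ e) * f ^+ b) <->
    x s * p%:R ^+ e <= b%:R.
  rewrite -expnD -exprM -exprD; apply: iff_trans (cE _ _) _.
  by rewrite /x mulrBl lerBlDl exprD mulrA natrD natrM natrX.
apply: contrapT => distinct.
(* If [x i = x j], then [c * (p ^ j - p ^ i)] equals [nu j - nu i], against [distinct]. *)
have x_inj (i j : 'I_N.+1) : x i = x j -> i = j.
  wlog ij : i j / (i <= j)%N.
    move=> wl xij; have [ij|/ltnW ji] := leqP i j; first exact: wl.
    by apply/esym; apply: wl => //; rewrite xij.
  move=> xij; apply/val_inj/eqP; rewrite eqn_leq ij leqNgt; apply/negP => lij.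
  apply: distinct; exists i, j; split=> //; exists (nu j - nu i)%N.
  have pij : (p ^ i <= p ^ j)%N by rewrite leq_exp2l ?prime_gt1.
  have eq_nu : c * p%:R ^+ j - c * p%:R ^+ i = (nu j)%:R - (nu i)%:R.
    apply/eqP; rewrite subr_eq -addrA [- _ + _]addrC -/(x i) xij.
    by rewrite addrC subrK.
  have nuij : (nu i <= nu j)%N.
    rewrite -(ler_nat R) -subr_ge0 -eq_nu subr_ge0 ler_pM2l// -!natrX.
    by rewrite ler_nat.
  by rewrite !natrB// mulrBr !natrX.
have [e gap] : exists e, forall s s' : 'I_N.+1, x s' < x s ->
    1 <= (x s - x s') * p%:R ^+ e.
  (* The sum bounds all inverse gaps at once; pairs with equal values contribute [0^-1 = 0]. *)
  pose B : R := \sum_(u : 'I_N.+1 * 'I_N.+1) `|(x u.1 - x u.2)^-1|.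
  exists (Num.truncn B).+1 => s s' xs.
  have xs0 : 0 < x s - x s' by rewrite subr_gt0.
  rewrite -ler_pdivrMl// mulr1; apply: (@le_trans _ _ B).
    rewrite /B (bigD1 (s, s'))//= gtr0_norm ?invr_gt0//.
    by rewrite lerDl sumr_ge0.
  apply: ltW; apply: lt_le_trans (truncnS_gt _) _.
  by rewrite -natrX ler_nat ltnW// ltn_expl// prime_gt1.
have /choice[b bP] s : exists a : nat, a%:R < x s * p%:R ^+ e <= a%:R + 1.
  by apply: low; rewrite mulr_gt0.
have pe0 : (0 < p ^ e)%N by rewrite expn_gt0 prime_gt0.
(* This bound, which comes from [x s <= 1], is the one required by [msize_kappa]. *)
have b_le s : (b s <= p ^ e)%N.
  rewrite -(ler_nat R) natrX; have /andP[/ltW + _] := bP s.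
  by move=> /le_trans; apply; rewrite ler_piMl// ltW.
pose F s := kappa (p ^ e) 0%MM ((f ^+ nu s) ^+ (p ^ e)).
have /choice[u uP] s : exists v : 'X_{1..n}, (forall i, v i < p ^ e)%N /\
    ~ monom_pow (p ^ s) (F s * kappa (p ^ e) v (f ^+ b s)).
  apply: contrapT => /forallNP allu; have /andP[+ _] := bP s.
  rewrite ltNge => /negP; apply; apply: (iffLR (good s e (b s))).
  apply/monom_pow_kappaP => // v vp.
  rewrite kappa_expM//; apply: contrapT => nv; apply: (allu v).
  by split.
(* Since [b s + 1 >= x s * p ^ e], a gap of at least one gives [b s >= x s' * p ^ e]. *)
have below s s' : 1 <= (x s - x s') * p%:R ^+ e ->
    monom_pow (p ^ s') (F s' * kappa (p ^ e) (u s) (f ^+ b s)).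
  move=> xs; have [us _] := uP s; rewrite -kappa_expM//.
  have : monom_pow (p ^ s' * p ^ e) ((f ^+ nu s') ^+ (p ^ e) * f ^+ b s).
    apply: (iffRL (good _ _ _)); rewrite -(lerD2r 1); have /andP[_] := bP s.
    by apply: le_trans; rewrite -lerBrDl -mulrBl.
  by move/(monom_pow_kappaP _ _ pe0); apply.
have [l lv [s0 ls0]] := mpoly_lindep
  (fun s : 'I_N.+1 => msize_kappa (u s) fd (b_le s) pe0 f0).
(* With [x s] minimal among the nonzero coefficients, multiplying the relation by [F s] puts all
   other terms into [monom_pow (p ^ s)], hence also the term of [s], against the choice of [u s]. *)
have [s ls smin] : exists2 s, l s != 0 & forall s', l s' != 0 -> x s <= x s'.
  case: (@arg_minP _ R 'I_N.+1 s0 (fun s => l s != 0) (fun s => x s) ls0).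
  by move=> s ls smin; exists s.
have [_] := uP s; apply.
rewrite -[F s * _]scale1r -(mulVf ls) -scalerA; apply: monom_powZ.
have := congr1 (fun h => F s * h) lv; rewrite (bigD1 s)//= mulr0 mulrDr -scalerAr.
move/eqP; rewrite addr_eq0 => /eqP ->; rewrite mulr_sumr -sumrN.
apply: ideal_sum => [|s' s's]; first exact: is_ideal_monom_pow.
rewrite -scalerAr -scaleNr; have [-> | ls'] := eqVneq (l s') 0.
  by rewrite oppr0 scale0r; case: (is_ideal_monom_pow K n (p ^ s)).
apply/monom_powZ/below/gap; rewrite lt_neqAle smin// andbT.
by apply: contra s's => /eqP/x_inj ->.
Qed.

(** A common multiple of all the denominators that [threshold_periodic] allows; being independent of
    the polynomial, it serves all combinations at once. *)
Definition threshold_denom (p N : nat) : nat :=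
  \prod_(i < N.+1) \prod_(j < N.+1 | (i < j)%N) (p ^ j - p ^ i)%N.

Lemma threshold_denom_gt0 p N : (1 < p)%N -> (0 < threshold_denom p N)%N.
Proof.
move=> p1; apply: prodn_cond_gt0 => i _; apply: prodn_cond_gt0 => j ij.
by rewrite subn_gt0 ltn_exp2l.
Qed.

Lemma threshold_denomP (R : realType) (K : fieldType) (n p d : nat)
    (f : {mpoly K[n]}) (c : R) :
  p \in [pchar K] -> f != 0 -> (msize f <= d)%N -> 0 < c ->
  (forall k e, monom_pow (p ^ e) (f ^+ k) <-> c * p%:R ^+ e <= k%:R) ->
  exists z : nat, c * (threshold_denom p #|{: 'X_{1..n < d}}|)%:R = z%:R.
Proof.
move=> pK f0 fd c0 cE.
have [i [j [ij [z cz]]]] := threshold_periodic pK f0 fd c0 cE.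
rewrite /threshold_denom (bigD1 i)//= (bigD1 j)//= -mulnA natrM mulrA cz -natrM.
by eexists.
Qed.

(** * The local ring at a point *)

Section ToLoc.

Variables (A L : idomainType) (ev : {rmorphism A -> L}).

Fact to_loc_is_zmod_morphism : zmod_morphism (@to_loc A L ev).
Proof. by move=> x y; apply: val_inj; rewrite /= tofracB. Qed.

Fact to_loc_is_monoid_morphism : monoid_morphism (@to_loc A L ev).
Proof.
by split=> [|x y]; apply: val_inj; rewrite /= ?tofrac1 ?tofracM.
Qed.

HB.instance Definition _ := GRing.isZmodMorphism.Build A (localization ev)
  (@to_loc A L ev) to_loc_is_zmod_morphism.
HB.instance Definition _ := GRing.isMonoidMorphism.Build A (localization ev)
  (@to_loc A L ev) to_loc_is_monoid_morphism.

Lemma to_loc_inj : injective (@to_loc A L ev).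
Proof. by move=> x y /(congr1 val) /eqP; rewrite tofrac_eq => /eqP. Qed.

Lemma locP (x : localization ev) :
  exists a b : A, ev b != 0 /\ x * to_loc ev b = to_loc ev a.
Proof.
have /regular_fracP[a [b [b0 xE]]] := loc_valP x; exists a, b; split=> //.
by apply: val_inj; rewrite /= xE divfK// (tofrac_neq0 b0).
Qed.

Lemma to_loc_unit (b : A) : ev b != 0 -> exists y, to_loc ev b * y = 1.
Proof.
move=> b0; have yP : FracField.tofrac 1 / FracField.tofrac b \in regular_frac ev.
  by apply/regular_fracP; exists 1, b.
exists (Localization yP); apply: val_inj.
by rewrite /= tofrac1 mul1r divff// (tofrac_neq0 b0).
Qed.

End ToLoc.

(** * Translation of a point to the origin *)

Definition shift (K : fieldType) (n : nat) (P : 'I_n -> K) (h : {mpoly K[n]}) :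
    {mpoly K[n]} :=
  h \mPo [tuple 'X_i + (P i)%:MP | i < n].

HB.instance Definition _ (K : fieldType) (n : nat) (P : 'I_n -> K) :=
  GRing.LRMorphism.copy (@shift K n P)
    (comp_mpoly [tuple 'X_i + (P i)%:MP | i < n]).

Lemma shiftX (K : fieldType) (n : nat) (P : 'I_n -> K) (m : 'X_{1..n}) :
  shift P 'X_[m] = \prod_(i < n) ('X_i + (P i)%:MP) ^+ m i.
Proof.
rewrite /shift comp_mpolyX; apply: eq_bigr => i _.
by rewrite tnth_map tnth_ord_tuple.
Qed.

Lemma shiftXU (K : fieldType) (n : nat) (P : 'I_n -> K) i :
  shift P 'X_i = 'X_i + (P i)%:MP.
Proof. by rewrite /shift comp_mpolyXU -tnth_nth tnth_map tnth_ord_tuple. Qed.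

Lemma shiftNK (K : fieldType) (n : nat) (P : 'I_n -> K) (h : {mpoly K[n]}) :
  shift (fun i => - P i) (shift P h) = h.
Proof.
rewrite {1}(mpolyE h) [RHS]mpolyE (raddf_sum (shift P)) (raddf_sum (shift _)) /=.
apply: eq_bigr => m _.
rewrite !linearZ /= shiftX rmorph_prod /=; congr (_ *: _); rewrite [RHS]mpolyXE_id.
apply: eq_bigr => i _; rewrite rmorphXn rmorphD /= shiftXU.
by rewrite [shift _ _%:MP]comp_mpolyC mpolyCN subrK.
Qed.

Lemma shiftKN (K : fieldType) (n : nat) (P : 'I_n -> K) (h : {mpoly K[n]}) :
  shift P (shift (fun i => - P i) h) = h.
Proof.
rewrite -[RHS](shiftNK (fun i => - P i)); congr (shift _ _).
by apply: boolp.funext => i; rewrite opprK.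
Qed.

Lemma mcoeff0_meval (K : fieldType) (n : nat) (h : {mpoly K[n]}) :
  h@_0 = h.@[fun=> 0].
Proof.
rewrite mevalE [in LHS](mpolyE h) raddf_sum /=; apply: eq_bigr => m _.
rewrite mcoeffZ mcoeffX; congr (_ * _); have [->|m0] := eqVneq m 0%MM.
  by rewrite big1// => i _; rewrite mnmE expr0.
apply/esym/eqP/prodf_eq0; apply: contrapT => all0; case/eqP: m0.
apply/mnmP => i; rewrite mnmE; apply/eqP; apply: contrapT => /negP mi.
by apply: all0; exists i => //; rewrite expf_eq0 lt0n mi eqxx.
Qed.

Lemma mcoeff0_shift (K : fieldType) (n : nat) (P : 'I_n -> K) (h : {mpoly K[n]}) :
  (shift P h)@_0 = h.@[P].
Proof.
rewrite mcoeff0_meval comp_mpoly_meval; apply: meval_eq => i.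
by rewrite tnth_map tnth_ord_tuple mevalD mevalXU mevalC add0r.
Qed.

Lemma monom_pow1 (K : fieldType) (n : nat) (h : {mpoly K[n]}) :
  monom_pow 1 h <-> h@_0 = 0.
Proof.
split=> [Mh|h0 a a1]; first by apply: Mh => i; rewrite mnmE.
suff -> : a = 0%MM by [].
by apply/mnmP => i; rewrite mnmE; have := a1 i; rewrite ltnS leqn0 => /eqP.
Qed.

(** * Frobenius powers of the maximal ideal and Frobenius roots in the local ring *)

Section LocalRing.

Variables (K : fieldType) (n p : nat) (P : 'I_n -> K).
Hypothesis pK : p \in [pchar K].

HB.instance Definition _ := GRing.RMorphism.copy (@to_local K n P)
  (to_loc (meval P : {rmorphism {mpoly K[n]} -> K})).

Let p_prime : prime p. Proof. exact: pcharf_prime pK. Qed.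

Let pA : p \in [pchar {mpoly K[n]}].
Proof. exact: (rmorph_pchar (@mpolyC n K)). Qed.

Lemma pchar_local : p \in [pchar local_ring P].
Proof. exact: (rmorph_pchar (to_local P) pA). Qed.

Lemma localP (x : local_ring P) :
  exists a b, b.@[P] != 0 /\ x * to_local P b = to_local P a.
Proof. exact: locP. Qed.

Lemma to_local_unit b : b.@[P] != 0 -> exists y, to_local P b * y = 1.
Proof. exact: to_loc_unit. Qed.

(* The [q]-th Frobenius power of the maximal ideal of the local ring at [P]. *)
Definition max_pow (q : nat) : set (local_ring P) :=
  [set x | exists a b, [/\ b.@[P] != 0, monom_pow q (shift P a) &
                          x * to_local P b = to_local P a]].

Lemma is_ideal_max_pow q : is_ideal (max_pow q).
Proof.
have [M0 MD MM] := is_ideal_monom_pow K n q.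
split=> [|x y [a [b [b0 Ma xb]]] [c [d [d0 Mc yd]]]|x y [a [b [b0 Ma yb]]]].
- by exists 0, 1; rewrite meval1 oner_neq0 !rmorph0 mul0r.
- exists (a * d + c * b), (b * d); split; first by rewrite mevalM mulf_neq0.
    by rewrite rmorphD !rmorphM /=; apply: MD; rewrite mulrC; apply: MM.
  rewrite rmorphD !rmorphM /= -xb -yd mulrDl mulrA -!mulrA.
  by rewrite [to_local P d * _]mulrC.
- have [c [d [d0 xd]]] := localP x.
  exists (c * a), (b * d); split; first by rewrite mevalM mulf_neq0.
    by rewrite rmorphM; apply: MM.
  by rewrite !rmorphM /= -xd -yb [RHS]mulrACA [to_local P d * _]mulrC.
Qed.

(** A denominator [B] is a nonzero constant [z] plus a polynomial without constant term, so
    [B ^+ (p ^ e)] agrees with [z ^+ (p ^ e)] modulo [monom_pow (p ^ e)]. Hence [F * B] in this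
    ideal forces [F] into it. *)
Lemma max_powP e f : max_pow (p ^ e) (to_local P f) <->
  monom_pow (p ^ e) (shift P f).
Proof.
have [M0 MD MM] := is_ideal_monom_pow K n (p ^ e).
split=> [[a [b [b0 Ma]]]|Mf]; last first.
  by exists f, 1; rewrite meval1 oner_neq0 rmorph1 mulr1.
rewrite -rmorphM => /to_loc_inj fb; move: Ma; rewrite -fb rmorphM /=.
set F := shift P f; set B := shift P b => MFB.
pose z := (B@_0)%:MP : {mpoly K[n]}.
have z0 : B@_0 != 0 by rewrite mcoeff0_shift.
have MBz : monom_pow (p ^ e) ((B - z) ^+ (p ^ e)).
  rewrite -[X in monom_pow X _]mul1n; apply/(monom_pow_exp pK)/monom_pow1.
  by rewrite mcoeffB mcoeffC eqxx mulr1 subrr.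
have MFz : monom_pow (p ^ e) (z ^+ (p ^ e) * F).
  have -> : z = B - (B - z) by rewrite opprB addrC subrK.
  have [k pe] : exists k, (p ^ e = k.+1)%N.
    by exists (p ^ e).-1; rewrite prednK// expn_gt0 prime_gt0.
  rewrite (exprD_pexp pA) mulrDl; apply: MD.
    by rewrite {2}pe exprSr -mulrA [B * F]mulrC; apply: MM.
  by rewrite mulrC exprNn mulrA; apply: (MM).
have -> : F = (B@_0 ^- (p ^ e)) *: (z ^+ (p ^ e) * F).
  rewrite /z -(rmorphXn (@mpolyC n K)) /= mul_mpolyC scalerA.
  by rewrite mulVf ?scale1r// expf_neq0.
exact: monom_powZ.
Qed.

Lemma max_pow1N1 : ~ max_pow 1 1.
Proof.
rewrite -(expn0 p) -(rmorph1 (to_local P)) => /max_powP; rewrite rmorph1 expn0.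
by move/monom_pow1/eqP; rewrite mcoeff1 eqxx oner_eq0.
Qed.

Lemma proper_sub_max (c : set (local_ring P)) : is_ideal c -> ~ c 1 ->
  c `<=` max_pow 1.
Proof.
move=> [c0 cD cM] c1 x cx; have [a [b [b0 xb]]] := localP x.
exists a, b; split=> //; apply/monom_pow1; rewrite mcoeff0_shift.
apply: contrapT => /eqP/to_local_unit[y ay]; apply: c1.
by rewrite -ay -xb -mulrA mulrC; apply: cM.
Qed.

Lemma frob_sub_max_pow (c : set (local_ring P)) e : is_ideal c -> ~ c 1 ->
  frob c (p ^ e) `<=` max_pow (p ^ e).
Proof.
move=> idc c1; apply: smallest_sub; first exact: is_ideal_max_pow.
move=> _ [x cx <-]; have [a [b [b0 Ma xb]]] := proper_sub_max idc c1 cx.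
exists (a ^+ (p ^ e)), (b ^+ (p ^ e)); split.
- by rewrite rmorphXn expf_neq0.
- rewrite rmorphXn -[X in monom_pow X _]mul1n.
  by apply/(monom_pow_exp pK).
- by rewrite !rmorphXn /= -exprMn xb.
Qed.

(** After translation, every monomial of the numerator is divisible by some [x_i^q]. *)
Lemma max_pow_sub_frob e : max_pow (p ^ e) `<=` frob (max_pow 1) (p ^ e).
Proof.
set q := (p ^ e)%N; have [F0 FD FM] := ideal_gen_is_ideal
  [set f ^+ q | f in max_pow 1].
move=> x [a [b [b0 Ma xb]]]; have [y by1] := to_local_unit b0.
rewrite -[x]mulr1 -by1 mulrA xb mulrC; apply: (FM).
rewrite -(shiftNK P a); move: (shift P a) Ma => h Mh.
rewrite (mpolyE h) big_seq (raddf_sum (shift _)) (raddf_sum (to_local P)) /=.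
apply: ideal_sum => // m mh.
have [i qi] : exists i, (q <= m i)%N.
  apply: contrapT => /forallNP mq; move: mh; rewrite mcoeff_msupp Mh ?eqxx// => i.
  by rewrite ltnNge; apply/negP/mq.
rewrite linearZ /= -mul_mpolyC !rmorphM; apply: (FM).
rewrite -[m](@submK _ (U_(i) *+ q)%MM); last first.
  apply/mnm_lepP => j; rewrite mulmnE mnm1E.
  case: eqP => [<-|_]; last by rewrite mul0n.
  by rewrite mul1n.
rewrite mpolyXD !rmorphM; apply: FM; rewrite -mpolyXn !rmorphXn.
apply: sub_gen_smallest; exists (to_local P (shift (fun i => - P i) 'X_i)) => //.
rewrite -(expn0 p); apply/max_powP; rewrite shiftKN expn0; apply/monom_pow1.
by rewrite mcoeffX mnm1_eq0.
Qed.

(** As the ring is local, some proper ideal has [J] in its Frobenius power exactly when the maximal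
    ideal does. *)
Lemma frob_rootN1 (J : set (local_ring P)) e :
  ~ frob_root J (p ^ e) 1 <-> J `<=` max_pow (p ^ e).
Proof.
split=> [|JM root1].
  move=> /existsNP[c /not_implyP[[idc Jc] c1]].
  by apply: subset_trans Jc _; apply: frob_sub_max_pow.
apply: max_pow1N1; apply: root1; split; first exact: is_ideal_max_pow.
exact: subset_trans JM (@max_pow_sub_frob e).
Qed.

Lemma bigcup_frob_root_proper (J : nat -> set (local_ring P)) :
  \bigcup_(e in [set: nat]) frob_root (J e) (p ^ e) <> setT <->
  forall e, J e `<=` max_pow (p ^ e).
Proof.
split=> [neqT e|JM JT].
  apply/frob_rootN1 => J1; apply: neqT; apply/seteqP; split=> // x _.
  exists e => // c [idc Jc].
  have c1 : c 1 by apply: J1.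
  by rewrite (ideal_unit idc c1).
have [e _] : (\bigcup_(e in [set: nat]) frob_root (J e) (p ^ e)) 1 by rewrite JT.
exact/frob_rootN1/JM.
Qed.

End LocalRing.

Lemma idealX_gen1_sub (S : comNzRingType) (x : S) (M : set S) k : is_ideal M ->
  idealX (ideal_gen [set x]) k `<=` M <-> M (x ^+ k).
Proof.
move=> idM; split=> [|].
  apply; elim: k => [|k IHk]; first by rewrite expr0.
  by rewrite exprS; apply: idealMmem => //; apply: sub_gen_smallest.
elim: k M idM => [|k IHk] M idM; first by rewrite expr0 => /(ideal_unit idM) ->.
rewrite exprS => Mx; apply: idealM_sub => // y z Iy Iz.
rewrite mulrC; move: y Iy; apply: smallest_sub; first exact: is_ideal_colon.
move=> _ /= ->; rewrite mulrC.
by move: z Iz; apply: (IHk [set z | M (x * z)]) => //; apply: is_ideal_colon.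
Qed.

Lemma extend_local_gen (K : fieldType) (n m : nat) (P : 'I_n -> K)
    (g : 'I_m -> {mpoly K[n]}) :
  extend_local P (ideal_gen (range g)) = ideal_gen (range (to_local P \o g)).
Proof.
have idL := ideal_gen_is_ideal (range (to_local P \o g)).
apply/seteqP; split; apply: smallest_sub => //.
- move=> _ [f If <-]; move: f If; apply: smallest_sub.
    case: idL => L0 LD LM; split=> [|x y Lx Ly|a x Lx] /=.
    + by rewrite rmorph0.
    + by rewrite rmorphD; apply: LD.
    + by rewrite rmorphM; apply: LM.
  by move=> _ [i _ <-]; apply: sub_gen_smallest; exists i.
- exact: ideal_gen_is_ideal.
- move=> _ [i _ <-]; apply: sub_gen_smallest; exists (g i) => //.
  by apply: sub_gen_smallest; exists i.
Qed.

(** * Least critical exponents and F-pure thresholds *)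

(** If [t < c], some [e] satisfies [(c - t) * p ^ e >= 1], and then the ceiling of [t * p ^ e] is
    less than [t * p ^ e + 1 <= c * p ^ e]. *)
Lemma ceil_pe_threshold (R : realType) (p : nat) (c t : R) : prime p -> 0 < t ->
  (forall e, c * p%:R ^+ e <= (ceil_pe p t e)%:R) <-> c <= t.
Proof.
move=> p_prime t0.
have p0 e : 0 < p%:R ^+ e :> R by rewrite exprn_gt0// ltr0n prime_gt0.
have tp0 e : 0 < t * p%:R ^+ e by rewrite mulr_gt0.
split=> [ct|ct e]; last first.
  by apply: (@le_trans _ _ (t * p%:R ^+ e));
    rewrite ?ler_pM2r// -(ceil_nat _ (ltW (tp0 e))).
rewrite leNgt; apply/negP => tc; have ct0 : 0 < c - t by rewrite subr_gt0.
pose e := (Num.truncn (c - t)^-1).+1.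
have gap : 1 <= (c - t) * p%:R ^+ e.
  rewrite -ler_pdivrMl// mulr1 ltW//; apply: lt_le_trans (truncnS_gt _) _.
  by rewrite -natrX ler_nat ltnW// ltn_expl// prime_gt1.
have := ct e; rewrite leNgt => /negP; apply.
have k0 : (0 < ceil_pe p t e)%N.
  by rewrite ltnNge (ceil_nat _ (ltW (tp0 e))) -ltNge.
have : (ceil_pe p t e).-1%:R < t * p%:R ^+ e.
  by rewrite ltNge -(ceil_nat _ (ltW (tp0 e))) -ltnNge prednK.
rewrite -(ltrD2r 1) natr1 prednK// => /lt_le_trans; apply.
by rewrite -lerBrDl -mulrBl.
Qed.

Lemma is_minimum_ge (R : realType) (Q : R -> Prop) (c c' : R) : 0 < c ->
  (forall t, 0 < t -> Q t <-> c <= t) ->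
  is_minimum [set t | 0 < t /\ Q t] c' <-> c' = c.
Proof.
move=> c0 Qc; have Qmin : is_minimum [set t | 0 < t /\ Q t] c.
  by split=> [|t [t0 /(Qc _ t0)]//]; split=> //; apply/(Qc _ c0).
split=> [[Qc' c'min]|->//]; apply/eqP; rewrite eq_le.
case: Qmin => Qc0 cmin.
by rewrite (c'min _ Qc0) (cmin _ Qc').
Qed.

Lemma test_ideal_properP (R : realType) (K : fieldType) (n p : nat)
    (P : 'I_n -> K) (f : {mpoly K[n]}) (t : R) : p \in [pchar K] ->
  test_ideal p (ideal_gen [set to_local P f]) t <> setT <->
  forall e, monom_pow (p ^ e) (shift P f ^+ ceil_pe p t e).
Proof.
move=> pK; apply: iff_trans (bigcup_frob_root_proper pK (fun e =>
  idealX (ideal_gen [set to_local P f]) (ceil_pe p t e))) _.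
have E e : idealX (ideal_gen [set to_local P f]) (ceil_pe p t e) `<=`
    @max_pow K n P (p ^ e) <-> monom_pow (p ^ e) (shift P f ^+ ceil_pe p t e).
  apply: iff_trans (idealX_gen1_sub _ _ (is_ideal_max_pow P _)) _.
  by rewrite -rmorphXn -rmorphXn; apply: max_powP.
by split=> h e; apply/E/h.
Qed.

Lemma frob_real_properP (R : realType) (K : closedFieldType) (n m p : nat)
    (P : 'I_n -> K) (g : 'I_m -> {mpoly K[n]}) (t : R) : p \in [pchar K] ->
  frob_real p (extend_local P (ideal_gen (range g))) t <> setT <->
  forall e gamma,
    monom_pow (p ^ e) (shift P (\sum_i gamma i *: g i) ^+ ceil_pe p t e).
Proof.
move=> pK; apply: iff_trans (bigcup_frob_root_proper pK (fun e =>
  frob_pow p (extend_local P (ideal_gen (range g))) (ceil_pe p t e))) _.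
have E e : frob_pow p (extend_local P (ideal_gen (range g))) (ceil_pe p t e) `<=`
    @max_pow K n P (p ^ e) <-> forall gamma,
    monom_pow (p ^ e) (shift P (\sum_i gamma i *: g i) ^+ ceil_pe p t e).
  rewrite extend_local_gen; have pL := pchar_local P pK.
  apply: iff_trans (frob_pow_subP pL (to_local P \o @mpolyC n K) _ _
    (is_ideal_max_pow P _)) _.
  have lin gamma : \sum_i (to_local P \o @mpolyC n K) (gamma i) *
      (to_local P \o g) i = to_local P (\sum_i gamma i *: g i).
    by rewrite raddf_sum /=; apply: eq_bigr => i _; rewrite -mul_mpolyC rmorphM.
  by split=> h gamma; have := h gamma; rewrite lin -!rmorphXn => /max_powP; apply.
by split=> h e; apply/E/h.
Qed.

(** In the generic combination [G] the coefficients are variables. Those of [G ^+ k] are polynomials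
    in [gamma], and the complement is the common zero set of the ones at exponents below [q]. *)
Lemma zariski_open_notin_monom_pow (K : fieldType) (n m q k : nat)
    (P : 'I_n -> K) (g : 'I_m -> {mpoly K[n]}) :
  zariski_open
    [set gamma | ~ monom_pow q (shift P (\sum_i gamma i *: g i) ^+ k)].
Proof.
pose G : {mpoly {mpoly K[m]}[n]} :=
  \sum_i 'X_i *: map_mpoly (@mpolyC m K) (shift P (g i)).
have GE (gamma : 'I_m -> K) :
    map_mpoly (meval gamma) G = shift P (\sum_i gamma i *: g i).
  rewrite /G !raddf_sum /=; apply: eq_bigr => i _.
  apply/mpolyP => a; rewrite linearZ /= mcoeff_map_mpoly !mcoeffZ.
  by rewrite mcoeff_map_mpoly /= mevalM mevalXU mevalC.
exists [set F | exists2 a : 'X_{1..n}, (forall i, a i < q)%N & F = (G ^+ k)@_a].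
apply/seteqP; split=> gamma /=.
  move=> /contrapT M _ [a aq ->].
  by rewrite -mcoeff_map_mpoly rmorphXn /= GE M.
move=> M; apply => a aq; rewrite -GE -rmorphXn mcoeff_map_mpoly.
by apply: M; exists a.
Qed.

Theorem theorem2 (R : realType) (p : nat) (p_prime : prime p)
    (K : closedFieldType) (iota : {rmorphism 'F_p -> K})
    (K_alg : forall x : K, algebraicOver iota x)
    (n m : nat) (g : 'I_m -> {mpoly K[n]})
    (a_neq0 : ideal_gen (range g) <> [set 0])
    (P : 'I_n -> K)
    (a_vanish : forall f, ideal_gen (range g) f -> f.@[P] = 0) :
  let U : set ('I_m -> K) :=
    [set gamma | let f := \sum_(i < m) gamma i *: g i in
       f <> 0 /\
       exists c : R, is_fpt_at p P f c /\ is_lce_at p P (ideal_gen (range g)) c]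
  in
  zariski_open U /\ U !=set0.
Proof.
move=> U.
have pK : p \in [pchar K] by apply: (rmorph_pchar iota); apply: pchar_Fp.
pose f (gamma : 'I_m -> K) := \sum_(i < m) gamma i *: g i.
pose h gamma := shift P (f gamma).
have h_eq0 gamma : (h gamma == 0) = (f gamma == 0).
  apply/eqP/eqP => [h0|f0]; last by rewrite /h f0 raddf0.
  by rewrite -(shiftNK P (f gamma)) -/(h gamma) h0 raddf0.
pose d := (\max_(i < m) msize (shift P (g i)))%N.
have h_size gamma : (msize (h gamma) <= d)%N.
  rewrite /h /f (raddf_sum (shift P)); apply: leq_trans (msize_sum _ _ _) _.
  apply/bigmax_leqP => i _. rewrite /= [shift P _]linearZ /=.
  by apply: leq_trans (msizeZ_le _ _) _; apply: leq_bigmax.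
have h_origin gamma : monom_pow 1 (h gamma).
  apply/monom_pow1; rewrite mcoeff0_shift; apply: a_vanish.
  apply: ideal_sum => [|i _]; first exact: ideal_gen_is_ideal.
  rewrite -mul_mpolyC; have [_ _ IM] := ideal_gen_is_ideal (range g).
  by apply: IM; apply: sub_gen_smallest; exists i.
(* At combinations with [f gamma = 0] the value [0] is a mere default. *)
have /choice[c cP] gamma : exists c : R, f gamma <> 0 -> [/\ 0 < c, c <= 1 &
    forall k e, monom_pow (p ^ e) (h gamma ^+ k) <-> c * p%:R ^+ e <= k%:R].
  have [f0|f0] := pselect (f gamma = 0); first by exists 0.
  have [|c cP] := @threshold_exists R _ _ _ (h gamma) pK _ (h_origin gamma).
    by rewrite h_eq0; apply/eqP.
  by exists c.
pose D := threshold_denom p #|{: 'X_{1..n < d}}|.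
have D0 : (0 < D)%N by apply: threshold_denom_gt0; apply: prime_gt1.
have cD gamma : f gamma <> 0 -> exists z : nat, c gamma * D%:R = z%:R.
  move=> /[dup] /eqP f0 /cP[c0 _ cE].
  by apply: (threshold_denomP pK _ (h_size gamma) c0 cE); rewrite h_eq0.
(* The numbers [c gamma * D] are naturals bounded by [D], so a largest threshold exists. *)
pose attained z := `[< exists2 gamma, f gamma <> 0 & c gamma * D%:R = z%:R >].
have [gamma1 f1] : exists gamma, f gamma <> 0.
  apply: contrapT => all0; apply: a_neq0; apply/seteqP; split=> [|_ ->]; last first.
    by case: (ideal_gen_is_ideal (range g)).
  apply: smallest_sub => [|_ [i _ <-]].
    by split=> [//|_ _ -> ->|b _ ->]; rewrite /set1/= ?addr0 ?mulr0.
  apply: contrapT => gi; apply: all0; exists (fun j => (j == i)%:R).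
  rewrite /f (bigD1 i)//= eqxx scale1r big1 ?addr0// => j ji.
  by rewrite (negPf ji) scale0r.
have attained_ex : exists z, attained z.
  by have [z cz] := cD _ f1; exists z; apply/asboolP; exists gamma1.
have attained_le z : attained z -> (z <= D)%N.
  move=> /asboolP[gamma /cP[_ c1 _] cz].
  by rewrite -(ler_nat R) -cz ler_piMl.
case: (ex_maxnP attained_ex attained_le) => z /asboolP[gamma0 f0 cz] z_max.
have [c0 _ _] := cP _ f0; set c' := c gamma0 in cz c0.
have c_max gamma : f gamma <> 0 -> c gamma <= c'.
  move=> fn; have [y cy] := cD _ fn.
  rewrite -(ler_pM2r (_ : 0 < D%:R)) ?ltr0n// cz cy ler_nat; apply: z_max.
  by apply/asboolP; exists gamma.
have fptE gamma t : f gamma <> 0 -> is_fpt_at p P (f gamma) t <-> t = c gamma.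
  move=> /cP[cg0 _ cE]; apply: is_minimum_ge => // s s0.
  apply: iff_trans (test_ideal_properP P (f gamma) s pK) _.
  rewrite -(ceil_pe_threshold (c gamma) p_prime s0).
  by split=> M e; apply/cE.
have lceE t : is_lce_at p P (ideal_gen (range g)) t <-> t = c'.
  apply: is_minimum_ge => // s s0.
  apply: iff_trans (frob_real_properP P g s pK) _.
  split=> [M|cs e gamma].
    apply/(ceil_pe_threshold c' p_prime s0) => e.
    by have [_ _ cE] := cP _ f0; apply/cE/M.
  (* The zero combination causes no obstruction: [s > 0] makes the exponent [ceil_pe p s e]
     positive, so the power is 0. *)
  have [fn|fn] := pselect (f gamma = 0).
    have [M0 _ _] := is_ideal_monom_pow K n (p ^ e).
    rewrite -/(f gamma) fn raddf0 expr0n gtn_eqF// ltnNge ceil_nat.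
      by rewrite -ltNge mulr_gt0// exprn_gt0// ltr0n prime_gt0.
    by rewrite mulr_ge0// ?exprn_ge0 ?ler0n ?ltW.
  have [_ _ cE] := cP _ fn; apply/cE.
  move: e; apply/(ceil_pe_threshold _ p_prime s0).
  by apply: le_trans cs; apply: c_max.
have UE gamma : U gamma <-> f gamma <> 0 /\ c gamma = c'.
  split=> [[fn [t [/(fptE _ _ fn) -> /lceE]]]//|[fn cg]].
  by split=> //; exists c'; split; [apply/(fptE _ _ fn)|apply/lceE].
split; last by exists gamma0; apply/UE.
(* Thresholds are multiples of [1/D], so [c gamma = c'] as soon as
   [c gamma > c' - 1/D]; the last condition is [c gamma > a / p^D]. *)
pose a := `|Num.ceil (c' * p%:R ^+ D)|%N.-1.
have p0 : 0 < p%:R ^+ D :> R by rewrite exprn_gt0// ltr0n prime_gt0.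
have cp0 : 0 < c' * p%:R ^+ D by rewrite mulr_gt0.
have ceil0 : (0 < `|Num.ceil (c' * p%:R ^+ D)|)%N.
  by rewrite ltnNge (ceil_nat _ (ltW cp0)) -ltNge.
have a_lt : a%:R < c' * p%:R ^+ D.
  by rewrite ltNge -(ceil_nat _ (ltW cp0)) -ltnNge prednK.
have a_ge : c' * p%:R ^+ D <= a%:R + 1.
  by rewrite natr1 prednK// -(ceil_nat _ (ltW cp0)).
have Dp : D%:R < p%:R ^+ D :> R by rewrite -natrX ltr_nat ltn_expl// prime_gt1.
have z0 : (0 < z)%N by rewrite -(ltr_nat R) -cz mulr_gt0// ltr0n.
(* Positivity of [a] keeps the zero combination out of the open set. It follows from
   [1 <= c' * D < c' * p ^ D <= a + 1]. *)
have a0 : (0 < a)%N.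
  rewrite -(ltr_nat R) -(ltrD2r 1) add0r; apply: lt_le_trans a_ge.
  apply: (@le_lt_trans _ _ (c' * D%:R)); last by rewrite ltr_pM2l.
  by rewrite cz ler1n.
suff -> : U = [set gamma | ~ monom_pow (p ^ D) (h gamma ^+ a)].
  exact: zariski_open_notin_monom_pow.
apply/seteqP; split=> gamma.
  move=> /UE[fn cg] /=; have [_ _ cE] := cP _ fn.
  by move/cE; rewrite cg leNgt a_lt.
move=> /= Mn; have fn : f gamma <> 0.
  move=> fn; apply: Mn; rewrite /h fn raddf0 expr0n gtn_eqF//.
  by case: (is_ideal_monom_pow K n (p ^ D)).
apply/UE; split=> //; have [_ _ cE] := cP _ fn.
have [y cy] := cD _ fn.
have D0R : D%:R != 0 :> R by rewrite pnatr_eq0 gtn_eqF.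
apply: (mulIf D0R); rewrite cy cz; congr (_%:R); apply/eqP.
rewrite eqn_leq z_max//=; last by apply/asboolP; exists gamma.
(* Together with [a_ge] this gives [(c' - c gamma) * p ^ D < 1]. As [D < p ^ D], also
   [(c' - c gamma) * D < 1], that is [z < y + 1]. *)
have : a%:R < c gamma * p%:R ^+ D by rewrite ltNge; apply/negP => /cE.
rewrite -(ltrD2r 1) => /(le_lt_trans a_ge).
rewrite -ltrBlDl -mulrBl => gap; rewrite -ltnS -(ltr_nat R) -natr1 -cz -cy.
rewrite -ltrBlDl -mulrBl; have [cc|cc] := leP (c' - c gamma) 0.
  by apply: le_lt_trans ltr01; rewrite pmulr_lle0// ltr0n.
by apply: lt_trans gap; rewrite ltr_pM2l.
Qed.
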